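(* If $M^0$ is positive definite, then an AAR solution of the uncertain LCP $$0\le z(\zeta)\perp M(\zeta)z(\zeta)+q\ge 0\quad\text{for all }\zeta\in\mathcal{U}$$ is unique if it exists.
   Context: Notation: vector inequalities are componentwise, and $0\le a\perp b\ge 0$ means $a\ge0$, $b\ge0$, $a^\top b=0$. A (not necessarily symmetric) matrix $M^0\in\mathbb{R}^{n\times n}$ is positive definite if $x^\top M^0x>0$ for all $x\in\mathbb{R}^n\setminus\{0\}$. Data: matrices $M^0,M^1,\dots,M^k\in\mathbb{R}^{n\times n}$, $q\in\mathbb{R}^n$, $h\in\{0,\dots,n\}$, the uncertainty set $\mathcal{U}=[-1,1]^k$, and $M(\zeta)=M^0+\sum_{i=1}^k\zeta_iM^i$ for $\zeta\in\mathcal{U}$. An affinely adjustable robust (AAR) solution of this uncertain LCP is an affine function $z(\zeta)=D\zeta+r$ with $D\in\mathbb{R}^{n\times k}$, $r\in\mathbb{R}^n$ and the first $h$ rows of $D$ equal to zero, such that $0\le z(\zeta)\perp M(\zeta)z(\zeta)+q\ge0$ for all $\zeta\in\mathcal{U}$. *)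

(* Defs.v *)
From mathcomp Require Import all_boot all_order all_algebra.
From mathcomp Require Import reals.

Set Implicit Arguments.
Unset Strict Implicit.
Unset Printing Implicit Defensive.

Import Order.TTheory GRing.Theory Num.Theory.

Local Open Scope ring_scope.

(* Symmetry of [A] is not required. *)
Definition posdef (R : realType) (n : nat) (A : 'M[R]_n) : Prop :=
  forall x : 'cV[R]_n, x != 0 -> 0 < (x^T *m A *m x) 0 0.

Definition vle (R : realType) (n : nat) (a b : 'cV[R]_n) : Prop :=
  forall i, a i 0 <= b i 0.

(* 0 <= a _|_ b >= 0 *)
Definition complementary (R : realType) (n : nat) (a b : 'cV[R]_n) : Prop :=
  [/\ vle 0 a, vle 0 b & (a^T *m b) 0 0 = 0].

Definition in_box (R : realType) (k : nat) (zeta : 'cV[R]_k) : Prop :=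
  forall i, -1 <= zeta i 0 <= 1.

Definition uncertain_mx (R : realType) (n k : nat) (M0 : 'M[R]_n)
    (M : 'I_k -> 'M[R]_n) (zeta : 'cV[R]_k) : 'M[R]_n :=
  M0 + \sum_(i < k) zeta i 0 *: M i.

(* The solution is the affine function [z] itself, taken on the whole of R^k;
   rows are numbered from 0, so the first [h] rows are those with [i < h]. *)
Definition AAR_solution (R : realType) (n k h : nat) (M0 : 'M[R]_n)
    (M : 'I_k -> 'M[R]_n) (q : 'cV[R]_n) (z : 'cV[R]_k -> 'cV[R]_n) : Prop :=
  (exists (D : 'M[R]_(n, k)) (r : 'cV[R]_n),
      (forall i : 'I_n, (i < h)%N -> row i D = 0) /\
      (forall zeta, z zeta = D *m zeta + r)) /\
  (forall zeta, in_box zeta ->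
      complementary (z zeta) (uncertain_mx M0 M zeta *m z zeta + q)).

(* Main.v *)
Require Import Defs.
From mathcomp Require Import all_boot all_order all_algebra.
From mathcomp Require Import reals.
Import Order.TTheory GRing.Theory Num.Theory.
Local Open Scope ring_scope.

(** Two solutions a, b of the same LCP satisfy (a - b)^T M(zeta) (a - b) <= 0.
    The difference of two AAR solutions is affine, d(zeta) = E zeta + s.  At
    zeta = 0 the inequality and positive definiteness of M0 give s = 0.  At
    zeta = t e_j with 0 < t <= 1 one may divide by t^2, obtaining
    u^T M0 u + t u^T M^j u <= 0 for u = E e_j; letting t tend to 0 gives
    u^T M0 u <= 0, hence u = 0. *)

Lemma vle0_dot_ge0 (R : realType) (n : nat) (a b : 'cV[R]_n) :
  vle 0 a -> vle 0 b -> 0 <= (a^T *m b) 0 0.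
Proof.
move=> a0 b0; rewrite mxE sumr_ge0 // => i _; rewrite mxE mulr_ge0 //.
- by have := a0 i; rewrite mxE.
- by have := b0 i; rewrite mxE.
Qed.

(** The vector [q] cancels in the difference of the slacks [w] and [y], so A(a - b) = w - y.
    Complementarity kills a^T w and b^T y, and what remains is -(a^T y + b^T w), a sum of products
    of nonnegative vectors with a minus sign. *)
Lemma complementary_sub_quad_le0 (R : realType) (n : nat) (A : 'M[R]_n)
    (q a b : 'cV[R]_n) :
  complementary a (A *m a + q) -> complementary b (A *m b + q) ->
  ((a - b)^T *m A *m (a - b)) 0 0 <= 0.
Proof.
set w := A *m a + q; set y := A *m b + q.
move=> [a0 w0 aw] [b0 y0 by0].
have -> : (a - b)^T *m A *m (a - b) = (a - b)^T *m (w - y).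
  by rewrite -mulmxA mulmxBr /w /y opprD addrACA subrr addr0.
rewrite [(a - b)^T]linearB mulmxBl !mulmxBr.
(* Stated for arbitrary 1 x 1 matrices so that [mxE] does not unfold the products into sums. *)
have -> (p1 p2 p3 p4 : 'M[R]_1) : (p1 - p2 - (p3 - p4)) 0 0 =
    p1 0 0 - p2 0 0 - (p3 0 0 - p4 0 0) by rewrite !mxE.
by rewrite aw by0 sub0r subr0 -opprD oppr_le0 addr_ge0 // vle0_dot_ge0.
Qed.

Lemma posdef_quad_le0 (R : realType) (n : nat) (A : 'M[R]_n) (x : 'cV[R]_n) :
  posdef A -> (x^T *m A *m x) 0 0 <= 0 -> x = 0.
Proof.
move=> pdA; case: (eqVneq x 0) => // /pdA + le0.
by rewrite ltNge le0.
Qed.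

(** An explicit [t] replaces the limit: if a > 0, then t = a / (a + |b|) lies in (0, 1] and a + t b
    >= a - t |b| = t a > 0. *)
Lemma le0_of_perturbation_le0 (R : realFieldType) (a b : R) :
  (forall t, 0 < t <= 1 -> a + t * b <= 0) -> a <= 0.
Proof.
move=> H; case: (lerP a 0) => // a0.
have c0 : 0 < a + `|b| by rewrite ltr_wpDr.
have t0 : 0 < a / (a + `|b|) by rewrite divr_gt0.
have /H : 0 < a / (a + `|b|) <= 1.
  by rewrite t0 ler_pdivrMr // mul1r lerDl normr_ge0.
rewrite leNgt => /negP[].
have tb : - (a / (a + `|b|) * `|b|) <= a / (a + `|b|) * b.
  by rewrite -mulrN ler_pM2l // lerNl -normrN ler_norm.
apply: lt_le_trans (lerD (lexx a) tb).
by rewrite -[X in X - _](divfK (lt0r_neq0 c0)) mulrDr addrK mulr_gt0.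
Qed.

Lemma in_box0 (R : realType) (k : nat) : in_box (0 : 'cV[R]_k).
Proof. by move=> i; rewrite mxE lerN10 ler01. Qed.

Lemma in_box_scale_delta (R : realType) (k : nat) (j : 'I_k) (t : R) :
  0 < t <= 1 -> in_box (t *: (delta_mx j 0 : 'cV[R]_k)).
Proof.
move=> /andP[t0 t1] i; rewrite !mxE eqxx andbT.
case: eqP => _; rewrite ?mulr1 ?mulr0 ?lerN10 ?ler01 // t1 andbT.
by apply: le_trans (ltW t0); rewrite lerN10.
Qed.

Lemma uncertain_mx0 (R : realType) (n k : nat) (M0 : 'M[R]_n)
    (M : 'I_k -> 'M[R]_n) : uncertain_mx M0 M 0 = M0.
Proof.
by rewrite /uncertain_mx big1 ?addr0 // => i _; rewrite mxE scale0r.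
Qed.

Lemma uncertain_mx_scale_delta (R : realType) (n k : nat) (M0 : 'M[R]_n)
    (M : 'I_k -> 'M[R]_n) (j : 'I_k) (t : R) :
  uncertain_mx M0 M (t *: delta_mx j 0) = M0 + t *: M j.
Proof.
rewrite /uncertain_mx (bigD1 j) //= big1 ?addr0 => [|i /negPf ij].
  by rewrite !mxE !eqxx mulr1.
by rewrite !mxE ij mulr0 scale0r.
Qed.

Lemma affine_quad_le0_eq0 (R : realType) (n k : nat) (M0 : 'M[R]_n)
    (M : 'I_k -> 'M[R]_n) (E : 'M[R]_(n, k)) (s : 'cV[R]_n) :
  posdef M0 ->
  (forall zeta, in_box zeta -> ((E *m zeta + s)^T *m uncertain_mx M0 M zeta
                                  *m (E *m zeta + s)) 0 0 <= 0) ->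
  E = 0 /\ s = 0.
Proof.
move=> pd H.
have s0 : s = 0.
  apply: posdef_quad_le0 pd _.
  by have := H _ (@in_box0 R k); rewrite uncertain_mx0 mulmx0 add0r.
split=> //.
(* The images of the unit vectors are the columns of [E]. *)
suff E0 j : E *m (delta_mx j 0 : 'cV_k) = 0.
  by apply/matrixP => i j; have /matrixP/(_ i 0) := E0 j; rewrite -colE !mxE.
apply: posdef_quad_le0 pd _.
set u := E *m _.
apply: (@le0_of_perturbation_le0 R _ ((u^T *m M j *m u) 0 0)) => t tP.
have := H _ (@in_box_scale_delta R k j t tP).
rewrite uncertain_mx_scale_delta s0 addr0 -scalemxAr -/u.
rewrite [(t *: u)^T]linearZ /= -scalemxAr -!scalemxAl mxE [X in t * X <= _]mxE.
have t0 : 0 < t by case/andP: tP.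
(* One factor [t] came from each copy of [t *: u]; both are cancelled here, while the one
   multiplying [M j] stays. *)
rewrite !pmulr_rle0 // mulmxDr mulmxDl -scalemxAr -scalemxAl.
by rewrite mxE [X in _ + X <= _]mxE.
Qed.

Theorem mainTheorem9 (R : realType) (n k h : nat) (hn : (h <= n)%N)
    (M0 : 'M[R]_n) (M : 'I_k -> 'M[R]_n) (q : 'cV[R]_n) :
  posdef M0 ->
  forall z1 z2 : 'cV[R]_k -> 'cV[R]_n,
    AAR_solution h M0 M q z1 -> AAR_solution h M0 M q z2 -> z1 =1 z2.
Proof.
move=> pd z1 z2 [[D1 [r1 [_ z1E]]] S1] [[D2 [r2 [_ z2E]]] S2].
have dE zeta : z1 zeta - z2 zeta = (D1 - D2) *m zeta + (r1 - r2).
  by rewrite z1E z2E mulmxBl opprD addrACA.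
(* Equality of the coefficients makes [z1] and [z2] agree on all of R^k, also outside the box. *)
have [D0 r0] : D1 - D2 = 0 /\ r1 - r2 = 0.
  apply: (@affine_quad_le0_eq0 R n k M0 M _ _ pd) => zeta zP.
  rewrite -dE.
  exact: complementary_sub_quad_le0 (S1 _ zP) (S2 _ zP).
by move=> zeta; apply/subr0_eq; rewrite dE D0 r0 mul0mx addr0.
Qed.
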